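(* Let $M=(V,\Gamma,\delta)$ be a cleaned-up MDP with target sets $F_i\subseteq V$, $i=1,\ldots,k$, where every state $v\in F=\bigcup_{i=1}^k F_i$ is absorbing. Let $\alpha\in\mathcal{D}(V\setminus F)$ be an initial distribution (so in particular $V\setminus F\neq\emptyset$), and let $r\in(0,1]^k$ be a vector of positive probabilities. Then the following are equivalent: (1) There is a (possibly randomized) memoryless strategy $\sigma$ such that $\bigwedge_{i=1}^k \Pr^\sigma_\alpha(\Diamond F_i)\ge r_i$. (2) There is a feasible solution $y'$ of the following system of linear constraints, in variables $y_v$ for $v\in F$ and $y_{(v,\gamma)}$ for $v\in V\setminus F$, $\gamma\in\Gamma_v$: $\sum_{\gamma\in\Gamma_v} y_{(v,\gamma)} - \sum_{v'\in V}\sum_{\gamma'\in\Gamma_{v'}} p_{(v',\gamma',v)}\, y_{(v',\gamma')} = \alpha(v)$ for all $v\in V\setminus F$; $y_v - \sum_{v'\in V\setminus F}\sum_{\gamma'\in\Gamma_{v'}} p_{(v',\gamma',v)}\, y_{(v',\gamma')} = 0$ for all $v\in F$; $y_v\ge 0$ for all $v\in F$; $y_{(v,\gamma)}\ge 0$ for all $v\in V\setminus F$, $\gamma\in\Gamma_v$; such that $\bigwedge_{i=1}^k \sum_{v\in F_i} y'_v \ge r_i$. (3) There is an arbitrary strategy $\sigma$ such that $\bigwedge_{i=1}^k \Pr^\sigma_\alpha(\Diamond F_i)\ge r_i$.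
   Context: An MDP $M=(V,\Gamma,\delta)$ has finite state set $V$, actions $\Gamma$ with enabled actions $\Gamma_v\neq\emptyset$ at each state $v$, and transition probabilities $p_{(v,\gamma,v')}$ (taken as $0$ when there is no transition), with $\sum_{v'}p_{(v,\gamma,v')}=1$. A strategy maps finite histories to distributions over enabled actions; it is memoryless if it depends only on the last state. $\Pr^\sigma_\alpha(\Diamond F_i)$ is the probability, under strategy $\sigma$ from initial distribution $\alpha$, of eventually reaching a state of $F_i$. A state $v\in V\setminus F$ is bad if there is no strategy $\sigma$ with $\Pr^\sigma_v(\Diamond F)>0$ (i.e. no path from $v$ to $F$ in the underlying graph of nonzero-probability transitions); the MDP is cleaned-up if it has no bad states (bad states may be removed, with residual probability implicitly going to a dead state outside $F$, so that action distributions may be substochastic). Each target state $v\in F$ is absorbing: $\Gamma_v=\{a\}$ and $(v,a,1,v)\in\delta$. *)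

(* Defs.v *)
From HB Require Import structures.
From mathcomp Require Import all_boot all_order all_algebra.
From mathcomp Require Import all_classical all_reals all_analysis.

Set Implicit Arguments.
Unset Strict Implicit.
Unset Printing Implicit Defensive.
Import Order.TTheory GRing.Theory Num.Theory.

Local Open Scope classical_set_scope.
Local Open Scope ring_scope.

Section fdist.
Variables (R : realType) (T : finType).

Record fdist := FDist {
  fdist_fun :> T -> R;
  fdist_ge0 : forall x, 0 <= fdist_fun x;
  fdist_sum1 : \sum_x fdist_fun x = 1 }.

Lemma fdirac_ge0 (a x : T) : 0 <= (x == a)%:R :> R.
Proof. by rewrite ler0n. Qed.

Lemma fdirac_sum1 (a : T) : \sum_x (x == a)%:R = 1 :> R.
Proof.
rewrite (bigD1 a)//= eqxx big1 ?addr0// => x /negPf ->.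
by [].
Qed.

Definition fdirac (a : T) : fdist := FDist (fdirac_ge0 a) (fdirac_sum1 a).

End fdist.
Arguments fdirac R {T} a.

(** * Probability measure on infinite runs

    A run is an infinite sequence over [option T]; the letter [None] stands for
    the dead state.  A history-dependent stochastic kernel [k] induces, by
    Caratheodory extension from the algebra of sets depending on finitely many
    coordinates, a probability measure [run_prob k] on the product
    sigma-algebra; [run_prob_cylinder] is its characteristic property. *)

Definition runs (T : finType) := nat -> option T.

HB.instance Definition _ (T : finType) := gen_eqMixin (runs T).
HB.instance Definition _ (T : finType) := gen_choiceMixin (runs T).
HB.instance Definition _ (T : finType) :=
  isPointed.Build (runs T) (fun=> None).

Section cylinder_algebra.
Variable T : finType.
Implicit Types A B : set (runs T).

Definition depends_on n A := forall w w' : runs T,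
  (forall i, (i < n)%N -> w i = w' i) -> A w -> A w'.

Definition finitary : set (set (runs T)) :=
  [set A | exists n, depends_on n A].

Lemma depends_on_le n m A : (n <= m)%N -> depends_on n A -> depends_on m A.
Proof.
by move=> nm dA w w' ww'; apply: dA => i ni; apply: ww'; exact: leq_trans nm.
Qed.

Lemma depends_onU n A B :
  depends_on n A -> depends_on n B -> depends_on n (A `|` B).
Proof.
by move=> dA dB w w' ww' [Aw|Bw]; [left; exact: dA Aw|right; exact: dB Bw].
Qed.

Lemma finitary0 : finitary set0.
Proof. by exists 0%N => w w' _ []. Qed.

Lemma finitaryU : setU_closed finitary.
Proof.
move=> A B [n dA] [m dB]; exists (maxn n m); apply: depends_onU.
- by apply: depends_on_le dA; exact: leq_maxl.
- by apply: depends_on_le dB; exact: leq_maxr.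
Qed.

Lemma finitaryC : setC_closed finitary.
Proof.
move=> A [n dA]; exists n => w w' ww' nAw Aw'; apply: nAw.
by apply: dA Aw' => i ni; rewrite ww'.
Qed.

End cylinder_algebra.

Definition cyl_display : measure_display. Proof. exact. Qed.

HB.instance Definition _ (T : finType) :=
  isAlgebraOfSets.Build cyl_display (runs T)
    (@finitary0 T) (@finitaryU T) (@finitaryC T).

Record run_kernel (R : realType) (T : finType) := RunKernel {
  kernel_fun :> seq (option T) -> option T -> R;
  kernel_ge0 : forall h x, 0 <= kernel_fun h x;
  kernel_sum1 : forall h, \sum_x kernel_fun h x = 1 }.

Section run_measure.
Variables (R : realType) (T : finType) (k : run_kernel R T).
Implicit Types (A B : set (runs T)) (h : seq (option T)).

(* Probability of [A], given the history [h], when [A] depends on at most the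
   first [size h + n] letters. *)
Fixpoint level n h A : R :=
  if n is n'.+1 then \sum_x k h x * level n' (rcons h x) A
  else `[< A (nth None h) >]%:R.

Definition run_content A : \bar R :=
  (level (xget 0%N [set n | depends_on n A]) [::] A)%:E.

Lemma level_ge0 n h A : 0 <= level n h A.
Proof.
elim: n h => [|n IH] h /=; first by rewrite ler0n.
by apply: sumr_ge0 => x _; rewrite mulr_ge0 ?kernel_ge0.
Qed.

Lemma levelS n h A :
  depends_on (size h + n) A -> level n.+1 h A = level n h A.
Proof.
elim: n h => [|n IH] h dA.
  rewrite /= -[RHS]mul1r -(kernel_sum1 k h) mulr_suml.
  apply: eq_bigr => x _.
  rewrite (@asbool_equiv_eq _ (A (nth None h)))//.
  by split; apply: dA => i; rewrite addn0 nth_rcons => ->.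
apply: eq_bigr => x _; congr (_ * _); apply: IH.
by rewrite size_rcons addSnnS.
Qed.

Lemma level_le n m A : depends_on n A -> (n <= m)%N ->
  level m [::] A = level n [::] A.
Proof.
move=> dA /subnKC <-; elim: (m - n)%N => [|j IH]; first by rewrite addn0.
rewrite addnS levelS ?IH//.
by apply: depends_on_le dA; exact: leq_addr.
Qed.

Lemma run_contentE n A : depends_on n A -> run_content A = (level n [::] A)%:E.
Proof.
move=> dA; rewrite /run_content.
have dx : depends_on (xget 0%N [set n | depends_on n A]) A.
  by exact: (@xgetI _ 0%N [set n | depends_on n A] n dA).
set m := xget _ _ in dx *; congr EFin.
by rewrite -(level_le dx (leq_maxl m n)) (level_le dA)// leq_maxr.
Qed.

Lemma level_mono n h A B : A `<=` B -> level n h A <= level n h B.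
Proof.
move=> AB; elim: n h => [|n IH] h /=.
  rewrite ler_nat; case: asboolP => // /AB Bh.
  by rewrite asboolT.
by apply: ler_sum => x _; rewrite ler_wpM2l ?kernel_ge0.
Qed.

Lemma levelU n h A B : A `&` B = set0 ->
  level n h (A `|` B) = level n h A + level n h B.
Proof.
move=> AB0; elim: n h => [|n IH] h /=; last first.
  rewrite -big_split/=; apply: eq_bigr => x _; by rewrite IH mulrDr.
rewrite asbool_or; case: asboolP => [Ah|_]; case: asboolP => [Bh|_];
  rewrite ?addr0 ?add0r//.
by have : (A `&` B) (nth None h) by []; rewrite AB0.
Qed.

Lemma levelU_le n h A B : level n h (A `|` B) <= level n h A + level n h B.
Proof.
have -> : A `|` B = A `|` (B `\` A).
  apply/seteqP; split=> w; last by move=> [Aw|[Bw _]]; [left|right].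
  by have [Aw|nAw] := pselect (A w); [left|move=> [//|Bw]; right].
rewrite levelU; last by rewrite setDE setICA setICr setI0.
by rewrite lerD2l level_mono//; exact: subDsetl.
Qed.

Lemma run_content0 : run_content set0 = 0%E.
Proof.
rewrite (@run_contentE 0%N)/=; last by move=> ? ? _ [].
by rewrite asboolF.
Qed.

Lemma run_content_ge0 A : (0 <= run_content A)%E.
Proof. by rewrite lee_fin level_ge0. Qed.

Lemma run_content_additive2 : measure_function.semi_additive2 run_content.
Proof.
move=> A B [n dA] [m dB] _ AB0.
have dA' := depends_on_le (leq_maxl n m) dA.
have dB' := depends_on_le (leq_maxr n m) dB.
by rewrite (run_contentE dA') (run_contentE dB')
  (run_contentE (depends_onU dA' dB')) levelU.
Qed.

Lemma run_content_additive : measure_function.semi_additive run_content.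
Proof.
apply/additive2P; first exact: run_content0.
by rewrite -semi_additive2E; exact: run_content_additive2.
Qed.

HB.instance Definition _ :=
  isContent.Build _ _ _ run_content run_content_ge0 run_content_additive.

(* Compactness of the space of runs. *)
Lemma finitary_compact A (F : (set (runs T))^nat) :
  finitary A -> (forall i, finitary (F i)) -> A `<=` \bigcup_i F i ->
  exists N, A `<=` \bigcup_(i < N) F i.
Proof.
move=> [n dA] mF AF; apply: contrapT => noN.
pose agree h (w : runs T) := forall i, (i < size h)%N -> w i = nth None h i.
pose bad h := forall N, exists2 w, A w & agree h w /\ ~ (\bigcup_(i < N) F i) w.
have bad0 : bad [::].
  move=> N; apply: contrapT => noW; apply: noN; exists N => w Aw.
  by apply: contrapT => nFw; apply: noW; exists w.
have badS h : bad h -> exists x, bad (rcons h x).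
  move=> bh; apply: contrapT => nox.
  have /choice[N HN] : forall x, exists N, ~ exists2 w, A w &
      agree (rcons h x) w /\ ~ (\bigcup_(i < N) F i) w.
    by move=> x; apply: contrapT => H; apply: nox; exists x => N;
       apply: contrapT => H'; apply: H; exists N.
  have [w Aw [hw nFw]] := bh (\max_x N x)%N.
  apply: (HN (w (size h))); exists w => //; split.
    move=> i; rewrite size_rcons ltnS leq_eqVlt nth_rcons.
    by case/orP => [/eqP ->|ih]; [rewrite ltnn eqxx|rewrite ih hw].
  move=> [i /= iN Fi]; apply: nFw; exists i => //=.
  by apply: leq_trans iN _; exact: leq_bigmax.
have /choice[f Hf] : forall h, exists x, bad h -> bad (rcons h x).
  move=> h; have [/badS[x bx]|nb] := pselect (bad h); first by exists x.
  by exists None.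
pose H := fix H n := if n is n'.+1 then rcons (H n') (f (H n')) else [::].
have badH m : bad (H m) by elim: m => //= m IH; exact: Hf.
have sizeH m : size (H m) = m by elim: m => //= m IH; rewrite size_rcons IH.
pose w : runs T := fun i => f (H i).
have nthH m i : (i < m)%N -> nth None (H m) i = w i.
  elim: m => //= m IH; rewrite ltnS leq_eqVlt nth_rcons sizeH.
  by case/orP => [/eqP ->|im]; [rewrite ltnn eqxx|rewrite im IH].
have Aw : A w.
  have [w' Aw' [aw' _]] := badH n 0%N.
  by apply: dA Aw' => i ni; rewrite aw' ?sizeH// nthH.
have [i _ Fiw] := AF _ Aw.
have [m dF] := mF i.
have [w' _ [aw' nFw']] := badH m i.+1.
apply: nFw'; exists i => //=.
by apply: dF Fiw => j jm; rewrite aw' ?sizeH// nthH.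
Qed.

Lemma run_content_sigma_subadditive :
  measurable_subset_sigma_subadditive run_content.
Proof.
move=> A F mF mA AF; have [N AFN] := finitary_compact mA mF AF.
have /choice[d dF] : forall i, exists n, depends_on n (F i) by [].
have [n dA] := mA.
have subadd m h : level m h (\bigcup_(i < N) F i) <= \sum_(i < N) level m h (F i).
  elim: N {AFN} => [|N IH].
    rewrite big_ord0 bigcup_mkord big_ord0.
    elim: m h => [|m IH] h /=; first by rewrite asboolF.
    by rewrite big1// => x _; apply/eqP; rewrite mulf_eq0; apply/orP; right;
       rewrite eq_le IH level_ge0.
  rewrite big_ord_recr/= bigcup_mkord big_ord_recr/= -bigcup_mkord.
  by apply: le_trans (levelU_le _ _ _ _) _; rewrite lerD2r.
pose m := maxn n (\max_(i < N) d i).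
have -> : run_content A = (level m [::] A)%:E.
  by apply: run_contentE; apply: depends_on_le dA; exact: leq_maxl.
apply: (@le_trans _ _ (\sum_(0 <= i < N) run_content (F i))%E); last first.
  by apply: nneseries_lim_ge => i _ _; exact: run_content_ge0.
rewrite big_mkord.
rewrite (eq_bigr (fun i : 'I_N => (level m [::] (F i))%:E)); last first.
  move=> i _; apply: run_contentE; apply: depends_on_le (dF i).
  by apply: leq_trans (leq_maxr _ _); exact: (leq_bigmax i).
by rewrite sumEFin lee_fin; apply: le_trans (level_mono _ _ AFN) _.
Qed.

HB.instance Definition _ :=
  Content_SigmaSubAdditive_isMeasure.Build _ _ _ run_content
    run_content_sigma_subadditive.

Definition run_prob : set (g_sigma_algebraType (@measurable _ (runs T))) -> \bar R :=
  measure_extension run_content.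

HB.instance Definition _ := Measure.on run_prob.

Lemma run_probE A : finitary A -> run_prob A = run_content A.
Proof. by move=> mA; rewrite /run_prob /measure_extension measurable_mu_extE. Qed.

Lemma run_prob_setT : run_prob setT = 1%E.
Proof.
rewrite run_probE; last by exists 0%N.
rewrite (@run_contentE 0%N)//=; first by rewrite asboolT.
Qed.

HB.instance Definition _ :=
  Measure_isProbability.Build _ _ _ run_prob run_prob_setT.

Lemma run_prob_cylinder (h : seq (option T)) :
  run_prob [set w | forall i, (i < size h)%N -> w i = nth None h i] =
  (\prod_(i < size h) k (take i h) (nth None h i))%:E.
Proof.
set A := [set w | _].
have dA : depends_on (size h) A.
  by move=> w w' ww' Aw i ih; rewrite -ww' ?Aw.
rewrite run_probE; last by exists (size h).
rewrite (run_contentE dA); congr EFin.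
suff gen s t : h = s ++ t -> level (size t) s A =
    \prod_(size s <= i < size h) k (take i h) (nth None h i).
  by rewrite (gen [::] h)// big_mkord.
elim: t s => [|x t IH] s hst /=.
  rewrite cats0 in hst; rewrite hst big_geq//= asboolT//.
  by rewrite -hst => i.
rewrite (bigD1 x)//= big1 ?addr0 => [|y yx].
  rewrite IH ?cat_rcons// [RHS]big_ltn; last first.
    by rewrite hst size_cat/= addnS ltnS leq_addr.
  by rewrite size_rcons hst take_size_cat// nth_cat ltnn subnn.
suff -> : level (size t) (rcons s y) A = 0 by rewrite mulr0.
suff z m s' : level m (rcons s y ++ s') A = 0.
  by have := z (size t) [::]; rewrite cats0.
elim: m s' => [|m IHm] s' /=; last first.
  by rewrite big1// => z _; rewrite rcons_cat IHm mulr0.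
rewrite asboolF// => /(_ (size s)).
rewrite hst size_cat/= addnS ltnS leq_addr => /(_ isT).
rewrite cat_rcons !nth_cat ltnn subnn/= => /eqP.
by rewrite (negPf yx).
Qed.

End run_measure.

(** * Markov decision processes *)

(* [mdp_trans v a v'] is the transition probability p_(v,a,v'). An enabled
   action may be substochastic; the missing mass goes to the dead state. *)
Record mdp (R : realType) (V G : finType) := MDP {
  mdp_enabled : V -> {set G};
  mdp_trans : V -> G -> V -> R;
  mdp_enabled_neq0 : forall v, mdp_enabled v != finset.set0;
  mdp_trans_ge0 : forall v a v', 0 <= mdp_trans v a v';
  mdp_trans_sum : forall v a, a \in mdp_enabled v ->
    \sum_v' mdp_trans v a v' <= 1;
  mdp_trans_disabled : forall v a v', a \notin mdp_enabled v ->
    mdp_trans v a v' = 0 }.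

(* [strat_fun s h v] is the choice made after the history [h] of state-action
   pairs followed by the current state [v]. *)
Record strategy (R : realType) (V G : finType) (M : mdp R V G) := Strategy {
  strat_fun :> seq (V * G) -> V -> fdist R G;
  strat_enabled : forall h v a, 0 < strat_fun h v a -> a \in mdp_enabled M v }.

Section mdp_semantics.
Variables (R : realType) (V G : finType) (M : mdp R V G).
Implicit Types (s : strategy M) (alpha : fdist R V) (S : {set V}) (v : V).

Definition memoryless s := forall h h' v a, s h v a = s h' v a.

Definition absorbing v :=
  exists a, mdp_enabled M v = [set a]%SET /\ mdp_trans M v a v = 1.

(* The letter at time i of a run is the state at time i together with the
   action chosen there, or [None] once the dead state is entered. *)
Definition mdp_step s alpha (h : seq (option (V * G))) (x : option (V * G)) : R :=
  if h is y :: h' then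
    match last y h', x with
    | Some (v, a), Some (v', a') => mdp_trans M v a v' * s (pmap id h) v' a'
    | Some (v, a), None => 1 - \sum_v' mdp_trans M v a v'
    | None, Some _ => 0
    | None, None => 1
    end
  else if x is Some (v, a) then alpha v * s [::] v a else 0.

Lemma mdp_trans_le1 v a : \sum_v' mdp_trans M v a v' <= 1.
Proof.
case: (boolP (a \in mdp_enabled M v)) => [/mdp_trans_sum//|na].
by rewrite big1// => v' _; exact: mdp_trans_disabled.
Qed.

Lemma mdp_step_ge0 s alpha h x : 0 <= mdp_step s alpha h x.
Proof.
case: h => [|y h] /=.
  by case: x => [[v a]|]//; rewrite mulr_ge0 ?fdist_ge0.
case: (last y h) => [[v a]|]; case: x => [[v' a']|] //.
  by rewrite mulr_ge0 ?mdp_trans_ge0 ?fdist_ge0.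
by rewrite subr_ge0 mdp_trans_le1.
Qed.

Lemma big_option_pair (f : option (V * G) -> R) :
  \sum_x f x = f None + \sum_v \sum_a f (Some (v, a)).
Proof.
rewrite (bigD1 None)//=; congr (_ + _).
rewrite pair_big/= (@reindex_omap _ _ _ _ _ Some id)/=; last by case.
by apply: eq_big => [[v a]|[v a]] //=; rewrite eqxx.
Qed.

Lemma mdp_step_sum1 s alpha h : \sum_x mdp_step s alpha h x = 1.
Proof.
have sumE (p : V -> R) g : \sum_v \sum_a p v * s g v a = \sum_v p v.
  by apply: eq_bigr => v _; rewrite -mulr_sumr fdist_sum1 mulr1.
rewrite big_option_pair; case: h => [|y h] /=.
  by rewrite add0r sumE fdist_sum1.
case: (last y h) => [[v a]|]; first by rewrite sumE subrK.
by rewrite big1 ?addr0// => v _; rewrite big1.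
Qed.

Definition mdp_kernel s alpha : run_kernel R (V * G)%type :=
  RunKernel (mdp_step_ge0 s alpha) (mdp_step_sum1 s alpha).

Definition reach S : set (runs (V * G)%type) :=
  [set w | exists n v a, w n = Some (v, a) /\ v \in S].

Definition Pr s alpha (E : set (runs (V * G)%type)) : \bar R :=
  run_prob (mdp_kernel s alpha) E.

Definition bad S v :=
  v \notin S /\ ~ exists s : strategy M, (0 < Pr s (fdirac R v) (reach S))%E.

Definition cleaned_up S := forall v, ~ bad S v.

(* [yF v] and [yA v a] are only meaningful for [v] in [S], resp. for [v] not in
   [S] and [a] enabled at [v]. The first family sums over all states; its
   summands with v' in [S] have coefficient 0 when [S] is absorbing. *)
Definition lp_feasible S (alpha : V -> R) (yF : V -> R) (yA : V -> G -> R) :=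
  [/\ forall v, v \notin S ->
        \sum_(a in mdp_enabled M v) yA v a
        - \sum_v' \sum_(a' in mdp_enabled M v') mdp_trans M v' a' v * yA v' a'
        = alpha v,
      forall v, v \in S ->
        yF v - \sum_(v' | v' \notin S) \sum_(a' in mdp_enabled M v')
                 mdp_trans M v' a' v * yA v' a' = 0,
      forall v, v \in S -> 0 <= yF v
    & forall v a, v \notin S -> a \in mdp_enabled M v -> 0 <= yA v a].

End mdp_semantics.

(* Main.v *)
Require Import Defs.
From mathcomp Require Import all_boot all_order all_algebra.
From mathcomp Require Import all_classical all_reals all_analysis.
From mathcomp Require Import ring lra.

(** Let [Y_N] be the expected numbers of visits to the state-action pairs outside
    [F] before time [N].  Flow conservation says that [Y_N] solves the linear
    system except that the mass still outside [F] at time [N] is missing from the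
    right-hand side.

    From a solution of the system, play each action with probability proportional
    to its value.  The solution exceeds [Y_N] by a nonnegative flow whose total
    decreases by at least the amount it sends into [F], so that amount tends to 0
    along some times and the solution values on [F] are reaching probabilities.

    From an arbitrary strategy, the mass left outside [F] at time [N] is routed on:
    since there are no bad states, a finite flow brings the mass at any single
    state down to less than 1, and iterating this makes it as small as desired.
    Hence the system is solvable up to any positive error.  Expected numbers of
    visits need not stay bounded as [N] grows, so compactness is not available;
    exact solvability follows instead from Fourier-Motzkin elimination, which shows
    that projections of polyhedra are closed. *)

Set Implicit Arguments.
Unset Strict Implicit.
Unset Printing Implicit Defensive.
Import Order.TTheory GRing.Theory Num.Theory.
Import numFieldNormedType.Exports.

Local Open Scope ring_scope.

(** * Closedness of systems of linear inequalities *)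

Section fourier_motzkin.
Variable R : realType.

(** The largest lower bound serves or, if there is none, the smallest upper bound. *)
Lemma separating_point (I : finType) (P Q : pred I) (l u : I -> R) :
  (forall i j, P i -> Q j -> l i <= u j) ->
  exists t, (forall i, P i -> l i <= t) /\ (forall j, Q j -> t <= u j).
Proof.
move=> lu; have [i0 Pi0|P0] := pickP P.
  case: (@arg_maxP _ _ _ i0 P l Pi0) => i Pi maxi.
  by exists (l i); split=> // j Qj; exact: lu.
have [j0 Qj0|Q0] := pickP Q.
  case: (@arg_minP _ _ _ j0 Q u Qj0) => j Qj minj.
  by exists (u j); split=> // i; rewrite P0.
by exists 0; split=> i; rewrite ?P0 ?Q0.
Qed.

Section elimination.
Variables (J : eqType) (j : J) (s : seq J) (I : finType).
Variables (A : I -> J -> R) (b c : I -> R).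

(* Fourier-Motzkin multipliers: the new row [(i, i')] is row [i] when [j] does
   not occur in it, a positive combination of rows [i] and [i'] cancelling [j]
   when the signs are opposite, and the trivial row otherwise. *)
Let m1 (p : I * I) : R :=
  if A p.1 j == 0 then 1 else
  if (0 < A p.1 j) && (A p.2 j < 0) then - A p.2 j else 0.
Let m2 (p : I * I) : R :=
  if A p.1 j == 0 then 0 else
  if (0 < A p.1 j) && (A p.2 j < 0) then A p.1 j else 0.

Definition fm_comb (f : I -> R) (p : I * I) : R := m1 p * f p.1 + m2 p * f p.2.
Definition fm_row (p : I * I) (i : J) : R := fm_comb (A ^~ i) p.

Lemma fm_comb_le (f g : I -> R) p :
  (forall i, f i <= g i) -> fm_comb f p <= fm_comb g p.
Proof.
move=> fg; rewrite /fm_comb lerD// ler_wpM2l// /m1 /m2.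
  by case: ifP => // _; case: ifP => // /andP[_ ?]; rewrite oppr_ge0 ltW.
by case: ifP => // _; case: ifP => // /andP[? _]; rewrite ltW.
Qed.

Lemma fm_row_sum p (x : J -> R) :
  \sum_(i <- s) fm_row p i * x i = fm_comb (fun i => \sum_(l <- s) A i l * x l) p.
Proof.
rewrite /fm_comb !mulr_sumr -big_split/=; apply: eq_bigr => i _.
by rewrite /fm_row /fm_comb; ring.
Qed.

Lemma fm_row_elim p : fm_row p j = 0.
Proof.
rewrite /fm_row /fm_comb /m1 /m2; case: eqP => [->|_]; first by ring.
by case: ifP => _; ring.
Qed.

(** The multipliers are nonnegative and cancel column [j]. The error is combined like [b], so the
    perturbed form of the system survives elimination. *)
Lemma fm_necessary e (x : J -> R) :
  (forall i, \sum_(l <- j :: s) A i l * x l <= b i + e * c i) ->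
  forall p, \sum_(l <- s) fm_row p l * x l <= fm_comb b p + e * fm_comb c p.
Proof.
move=> Ax p; have := fm_comb_le p Ax.
have -> : fm_comb (fun i => b i + e * c i) p = fm_comb b p + e * fm_comb c p.
  by rewrite /fm_comb; ring.
apply: le_trans; rewrite fm_row_sum.
have e1 : fm_comb (fun i => \sum_(l <- j :: s) A i l * x l) p =
    fm_row p j * x j + fm_comb (fun i => \sum_(l <- s) A i l * x l) p.
  by rewrite /fm_row /fm_comb !big_cons; ring.
by rewrite e1 fm_row_elim mul0r add0r.
Qed.

(** Rows bound variable [j] from below or above according to the sign of its coefficient. The
    combined rows say that every lower bound is at most every upper bound. *)
Lemma fm_sufficient (x : J -> R) : j \notin s ->
  (forall p, \sum_(l <- s) fm_row p l * x l <= fm_comb b p) ->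
  exists y : J -> R, forall i, \sum_(l <- j :: s) A i l * y l <= b i.
Proof.
move=> js Ax; pose S i := \sum_(l <- s) A i l * x l.
have [] := @separating_point I (fun i => A i j < 0) (fun i => 0 < A i j)
  (fun i => (b i - S i) / A i j) (fun i => (b i - S i) / A i j).
  move=> i' i Ai' Ai; have := Ax (i, i').
  rewrite fm_row_sum /fm_comb /m1 /m2/= gt_eqF// Ai Ai'/= -!/(S _) => H.
  rewrite ler_pdivlMr// mulrAC ler_ndivrMr//; nra.
move=> t [lot upt]; exists (fun l => if l == j then t else x l) => i.
rewrite big_cons eqxx.
have -> : \sum_(l <- s) A i l * (if l == j then t else x l) = S i.
  rewrite /S !big_seq; apply: eq_bigr => l ls; case: eqP => // lj.
  by rewrite -lj ls in js.
case: (ltgtP (A i j) 0) => Aij.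
- by have := lot i Aij; rewrite ler_ndivrMr//; lra.
- by have := upt i Aij; rewrite ler_pdivlMr//; lra.
- have := Ax (i, i); rewrite fm_row_sum /fm_comb /m1 /m2/= Aij eqxx.
  by rewrite -!/(S _); lra.
Qed.

End elimination.

(** Induction on the variables. With none left, [0 <= b i + e * c i] for all [e > 0] forces
    [0 <= b i]. *)
Lemma approx_feasible_seq (J : eqType) (s : seq J) (I : finType)
    (A : I -> J -> R) (b c : I -> R) : uniq s ->
  (forall e, 0 < e -> exists x : J -> R,
    forall i, \sum_(l <- s) A i l * x l <= b i + e * c i) ->
  exists x : J -> R, forall i, \sum_(l <- s) A i l * x l <= b i.
Proof.
elim: s I A b c => [|j s IH] I A b c /=.
  move=> _ H; exists (fun=> 0) => i; rewrite big_nil.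
  apply/ler_addgt0Pr => e e0.
  have e1 : 0 < e / (`|c i| + 1) by rewrite divr_gt0// ltr_wpDl.
  have [x /(_ i)] := H _ e1; rewrite big_nil => /le_trans; apply.
  rewrite lerD2l -mulrA ger_pMr// mulrC ler_pdivrMr ?ltr_wpDl// mul1r.
  by rewrite (le_trans (ler_norm _))// lerDl.
move=> /andP[js us] H.
have [x Hx] : exists x : J -> R, forall p,
    \sum_(l <- s) fm_row j A p l * x l <= fm_comb j A b p.
  apply: (IH _ _ _ (fm_comb j A c)) => // e /H[x Hx].
  by exists x; exact: fm_necessary Hx.
exact: fm_sufficient js Hx.
Qed.

Lemma approx_feasible (I J : finType) (A : I -> J -> R) (b c : I -> R) :
  (forall e, 0 < e -> exists x : J -> R,
    forall i, \sum_l A i l * x l <= b i + e * c i) ->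
  exists x : J -> R, forall i, \sum_l A i l * x l <= b i.
Proof. by apply: approx_feasible_seq; rewrite index_enum_uniq. Qed.

End fourier_motzkin.

(** * Occupation probabilities and reachability *)

Section expectation.
Variables (R : realType) (T : finType) (k : run_kernel R T).
Implicit Types (h : seq (option T)) (f g : seq (option T) -> R).

(** Expectation of [f] at the history reached from [h] after [n] more letters; a finite sum in place
    of an integral over runs. *)
Fixpoint expect n h f : R :=
  if n is n'.+1 then \sum_x k h x * expect n' (rcons h x) f else f h.

Lemma levelE n h A :
  level k n h A = expect n h (fun h' => `[< A (nth None h') >]%:R).
Proof. by elim: n h => //= n IH h; apply: eq_bigr => x _; rewrite IH. Qed.

Lemma eq_expect n h f g :
  (forall h', size h' = (size h + n)%N -> f h' = g h') ->
  expect n h f = expect n h g.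
Proof.
elim: n h => [|n IH] h fg /=; first by rewrite fg// addn0.
by apply: eq_bigr => x _; rewrite IH// => h' h'E; rewrite fg// h'E size_rcons addSnnS.
Qed.

(** The recursion in [expect] peels off the first new letter; forward recursions in time need the
    last one. *)
Lemma expectSr n h f :
  expect n.+1 h f = expect n h (fun h' => \sum_x k h' x * f (rcons h' x)).
Proof. by elim: n h => //= n IH h; apply: eq_bigr => x _; rewrite -IH. Qed.

Lemma expect0 n h : expect n h (fun=> 0) = 0.
Proof. by elim: n h => //= n IH h; rewrite big1// => x _; rewrite IH mulr0. Qed.

Lemma expect_ge0 n h f : (forall h', 0 <= f h') -> 0 <= expect n h f.
Proof.
move=> f0; elim: n h => //= n IH h.
by apply: sumr_ge0 => x _; rewrite mulr_ge0 ?kernel_ge0.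
Qed.

Lemma expectMr n h f (c : R) : expect n h (fun h' => f h' * c) = expect n h f * c.
Proof.
elim: n h => //= n IH h; rewrite mulr_suml.
by apply: eq_bigr => x _; rewrite IH mulrA.
Qed.

Lemma expect_sum n h (I : finType) (P : pred I) (F : I -> seq (option T) -> R) :
  expect n h (fun h' => \sum_(i | P i) F i h') = \sum_(i | P i) expect n h (F i).
Proof.
elim: n h => //= n IH h; rewrite exchange_big/=.
by apply: eq_bigr => x _; rewrite IH mulr_sumr.
Qed.

Lemma run_prob_level n A : depends_on n A -> run_prob k A = (level k n [::] A)%:E.
Proof. by move=> dA; rewrite run_probE; [exact: run_contentE|exists n]. Qed.

End expectation.

(** * Occupation probabilities of state-action pairs *)

Section occupation.
Variables (R : realType) (V G : finType) (M : mdp R V G).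
Variables (s : strategy M) (alpha : fdist R V).
Implicit Types (S : {set V}) (v : V) (a : G).

Lemma strat_disabled h v a : a \notin mdp_enabled M v -> s h v a = 0.
Proof.
move=> na; apply/eqP; rewrite eq_le fdist_ge0 andbT leNgt.
by apply: contra na => /strat_enabled.
Qed.

Lemma absorbing_trans v a v' : absorbing M v -> a \in mdp_enabled M v ->
  mdp_trans M v a v' = (v' == v)%:R.
Proof.
move=> [b [-> pb]]; rewrite inE => /eqP ->; have [->//|v'v] := eqVneq v' v.
apply/eqP; rewrite eq_le mdp_trans_ge0 andbT.
have := mdp_trans_le1 M v b; rewrite (bigD1 v)//= (bigD1 v')//= pb.
by have : 0 <= \sum_(i | (i != v) && (i != v')) mdp_trans M v b i
  by [apply: sumr_ge0 => *; exact: mdp_trans_ge0]; lra.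
Qed.

Lemma absorbing_trans_out v a v' : absorbing M v -> v' != v ->
  mdp_trans M v a v' = 0.
Proof.
move=> av v'v; case: (boolP (a \in mdp_enabled M v)) => aE.
  by rewrite absorbing_trans// (negPf v'v).
exact: mdp_trans_disabled.
Qed.

Definition occ n v a : R :=
  expect (mdp_kernel s alpha) n [::] (fun h => mdp_step s alpha h (Some (v, a))).

Definition occ_state n v : R := \sum_a occ n v a.

Lemma occ_ge0 n v a : 0 <= occ n v a.
Proof. by apply: expect_ge0 => h; exact: mdp_step_ge0. Qed.

Lemma mdp_step_disabled h v a : a \notin mdp_enabled M v ->
  mdp_step s alpha h (Some (v, a)) = 0.
Proof.
move=> na; case: h => [|y h] /=; first by rewrite strat_disabled ?mulr0.
by case: last => [[v' a']|]//; rewrite strat_disabled ?mulr0.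
Qed.

Lemma occ_disabled n v a : a \notin mdp_enabled M v -> occ n v a = 0.
Proof.
move=> na; rewrite -[RHS](expect0 (mdp_kernel s alpha) n [::]).
by apply: eq_expect => h _; exact: mdp_step_disabled.
Qed.

Lemma occ_state0 v : occ_state 0 v = alpha v.
Proof.
by rewrite /occ_state /occ/= -mulr_sumr fdist_sum1 mulr1.
Qed.

Lemma mdp_step_rcons h x y : mdp_step s alpha (rcons h x) y =
  match x, y with
  | Some (v, a), Some (v', a') =>
      mdp_trans M v a v' * s (pmap id (rcons h x)) v' a'
  | Some (v, a), None => 1 - \sum_v' mdp_trans M v a v'
  | None, Some _ => 0
  | None, None => 1
  end.
Proof. by case: h => [|z h] //=; rewrite last_rcons. Qed.

(** Forward equation: the probabilities of the next action sum to 1 and the dead state has no way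
    back, so only transition probabilities remain. *)
Lemma occ_stateS n v :
  occ_state n.+1 v = \sum_v' \sum_a' mdp_trans M v' a' v * occ n v' a'.
Proof.
rewrite /occ_state -expect_sum expectSr.
transitivity (expect (mdp_kernel s alpha) n [::] (fun h =>
    \sum_v' \sum_a' mdp_step s alpha h (Some (v', a')) * mdp_trans M v' a' v)).
  apply: eq_expect => h _; rewrite big_option_pair /=.
  rewrite [X in _ * X]big1 ?mulr0 ?add0r; last first.
    by move=> a _; rewrite mdp_step_rcons.
  apply: eq_bigr => v' _; apply: eq_bigr => a' _; congr (_ * _).
  under eq_bigr do rewrite mdp_step_rcons.
  by rewrite -mulr_sumr fdist_sum1 mulr1.
rewrite expect_sum; apply: eq_bigr => v' _; rewrite expect_sum.
by apply: eq_bigr => a' _; rewrite expectMr mulrC.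
Qed.

Lemma occ_memoryless n v a : memoryless s ->
  occ n v a = occ_state n v * s [::] v a.
Proof.
move=> ms; rewrite /occ_state -expect_sum -expectMr; apply: eq_expect => h _.
case: h => [|y h] /=; first by rewrite -mulr_sumr fdist_sum1 mulr1.
case: last => [[v' a']|]; last by rewrite big1// mul0r.
by rewrite -mulr_sumr fdist_sum1 mulr1; congr (_ * _); exact: ms.
Qed.

Definition in_state S (x : option (V * G)) := if x is Some (v, _) then v \in S else false.

Definition at_time S n : set (runs (V * G)%type) := [set w | in_state S (w n)]%classic.

Lemma depends_at_time S n : depends_on n.+1 (at_time S n).
Proof. by move=> w w' ww'; rewrite /at_time /= ww'. Qed.

Lemma Pr_at_time S n : Pr s alpha (at_time S n) = (\sum_(v in S) occ_state n v)%:E.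
Proof.
rewrite /Pr (run_prob_level _ (@depends_at_time S n)) levelE expectSr; congr EFin.
under [RHS]eq_bigr do rewrite /occ_state -expect_sum.
rewrite -expect_sum; apply: eq_expect => h; rewrite add0n => sh.
have at_h x : `[< at_time S n (nth None (rcons h x)) >] = in_state S x.
  by rewrite /at_time/= nth_rcons sh ltnn eqxx asboolb.
rewrite big_option_pair at_h /= mulr0 add0r [RHS]big_mkcond/=.
apply: eq_bigr => v _; case: ifP => vS; last first.
  by rewrite big1// => a _; rewrite at_h /= vS mulr0.
by apply: eq_bigr => a _; rewrite at_h /= vS mulr1.
Qed.

(** Sequences leaving [S] do exist in the run space, but with probability 0: the self-loop has mass
    1, which leaves nothing for other states or the dead state. *)
Lemma Pr_leave_absorbing S n : (forall v, v \in S -> absorbing M v) ->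
  Pr s alpha (at_time S n `\` at_time S n.+1)%classic = 0%E.
Proof.
move=> aS.
have dA : depends_on n.+2 (at_time S n `\` at_time S n.+1)%classic.
  by move=> w w' ww'; rewrite /at_time/= /setD/= !ww'.
rewrite /Pr (run_prob_level _ dA) levelE !expectSr; congr EFin.
rewrite -[RHS](expect0 (mdp_kernel s alpha) n [::]).
apply: eq_expect => h; rewrite add0n => sh; rewrite big1// => x _.
case: (boolP (in_state S x)) => xS; last first.
  rewrite big1 ?mulr0// => y _; rewrite asboolF ?mulr0// => -[].
  by rewrite /at_time/= !nth_rcons size_rcons sh leqnn ltnn eqxx (negPf xS).
case: x xS => [[v a]|]//= vS.
case: (boolP (a \in mdp_enabled M v)) => aE; last first.
  by rewrite mdp_step_disabled ?mul0r.
rewrite big1 ?mulr0// => y _.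
rewrite mdp_step_rcons; case: y => [[v' a']|].
  have [->|v'v] := eqVneq v' v; last first.
    by rewrite (absorbing_trans_out _ (aS _ vS))// !mul0r.
  rewrite asboolF ?mulr0// => -[_]; apply.
  by rewrite /at_time/= nth_rcons size_rcons sh ltnn eqxx.
rewrite (bigD1 v)//= (absorbing_trans _ (aS _ vS))// eqxx big1 ?addr0 ?subrr ?mul0r//.
by move=> u uv; rewrite (absorbing_trans_out _ (aS _ vS)).
Qed.

(** * Reaching an absorbing set *)

Lemma depends_measurable n (A : set (runs (V * G)%type)) :
  depends_on n A -> measurable (A : set (g_sigma_algebraType
    (@measurable _ (runs (V * G)%type)))).
Proof. by move=> dA; apply: sub_sigma_algebra; exists n. Qed.

Definition within S n : set (runs (V * G)%type) :=
  [set w | exists2 m, (m <= n)%N & at_time S m w]%classic.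

Lemma depends_within S n : depends_on n.+1 (within S n).
Proof.
move=> w w' ww' [m mn Sm]; exists m => //.
by apply: (depends_at_time _ Sm) => i im; apply: ww'; exact: leq_trans im _.
Qed.

Lemma reach_bigcup S : reach S = (\bigcup_n within S n)%classic.
Proof.
apply/seteqP; split=> w.
  move=> [n [v [a [wn vS]]]]; exists n => //; exists n => //.
  by rewrite /at_time/= wn.
move=> [n _ [m _]]; rewrite /at_time/=; case wm : (w m) => [[v a]|]//= vS.
by exists m, v, a.
Qed.

Lemma measurable_reach S : measurable (reach S : set (g_sigma_algebraType
  (@measurable _ (runs (V * G)%type)))).
Proof.
rewrite reach_bigcup; apply: bigcup_measurable => n _.
exact: depends_measurable (@depends_within S n).
Qed.

Lemma Pr_at_time_le_reach S n :
  ((\sum_(v in S) occ_state n v)%:E <= Pr s alpha (reach S))%E.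
Proof.
rewrite -Pr_at_time /Pr; apply: le_measure; rewrite ?inE.
- exact: depends_measurable (@depends_at_time S n).
- exact: measurable_reach.
by move=> w Sw; rewrite reach_bigcup; exists n => //; exists n.
Qed.

Lemma Pr_within_absorbing S n : (forall v, v \in S -> absorbing M v) ->
  (Pr s alpha (within S n) <= (\sum_(v in S) occ_state n v)%:E)%E.
Proof.
move=> aS; rewrite -Pr_at_time.
have mA m := depends_measurable (@depends_at_time S m).
have mW m := depends_measurable (@depends_within S m).
have null : Pr s alpha (within S n `\` at_time S n)%classic = 0%E.
  elim: n => [|n IH].
    rewrite (_ : (_ `\` _)%classic = set0) ?measure0//.
    by apply/seteqP; split=> w // -[[m]]; rewrite leqn0 => /eqP ->.
  apply/eqP; rewrite eq_le measure_ge0 andbT.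
  (* A run that has visited [S] but is outside it at time [n.+1] was already outside after a visit
     at time [n], or leaves [S] in between. *)
  rewrite -[leRHS](adde0 0%E) -{1}IH -(Pr_leave_absorbing n aS).
  apply: le_trans (measureU2 _ _ _); [|exact: measurableD..].
  apply: le_measure; rewrite ?inE; [exact: measurableD| |].
    by apply: measurableU; exact: measurableD.
  move=> w [[m mn Sm] nS]; have [Sn|nSn] := pselect (at_time S n w).
    by right.
  left; split=> //; exists m => //; rewrite -ltnS ltn_neqAle mn andbT.
  by apply/eqP => mE; apply: nS; rewrite -mE.
rewrite -[leRHS]adde0 -null; apply: le_trans (measureU2 _ _ _).
- apply: le_measure; rewrite ?inE//.
    by apply: measurableU => //; exact: measurableD.
  by move=> w Ww; have [?|?] := pselect (at_time S n w); [left|right].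
- exact: mA.
- exact: measurableD.
Qed.

(** Continuity of the measure from below along the increasing events [within S n]. *)
Lemma reach_absorbing_approx S (r e : R) : (forall v, v \in S -> absorbing M v) ->
  ((r%:E <= Pr s alpha (reach S))%E) -> 0 < e ->
  \forall n \near \oo%classic, r - e <= \sum_(v in S) occ_state n v.
Proof.
move=> aS rP e0.
have mW m := depends_measurable (@depends_within S m).
have cv : (Pr s alpha (within S n) @[n --> \oo] --> Pr s alpha (reach S))%classic.
  rewrite reach_bigcup; apply: nondecreasing_cvg_mu => //.
    by rewrite -reach_bigcup; exact: measurable_reach.
  move=> n m nm; apply/subsetPset => w [i ni Si]; exists i => //.
  exact: leq_trans nm.
have lt : ((r - e)%:E < Pr s alpha (reach S))%E.
  by apply: lt_le_trans rP; rewrite lte_fin; lra.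
have lt_near : \forall n \near \oo%classic, ((r - e)%:E < Pr s alpha (within S n))%E.
  apply: (cv [set y | ((r - e)%:E < y)%E]%classic).
  by apply: open_nbhs_nbhs; split=> //; exact: open_ereal_gt_ereal.
near=> n; rewrite -lee_fin; apply: le_trans (Pr_within_absorbing n aS).
by apply: ltW; near: n.
Unshelve. all: by end_near. Qed.

End occupation.

(** * Flows *)

Section flows.
Variables (R : realType) (V G : finType) (M : mdp R V G) (F : {set V}).
Hypothesis F_absorbing : forall v, v \in F -> absorbing M v.
Implicit Types (y z : V -> G -> R) (mu nu : V -> R) (v u : V) (a : G).

Definition inflow y v : R := \sum_v' \sum_a' mdp_trans M v' a' v * y v' a'.

Definition outflow y v : R := \sum_a y v a.

Definition net y v : R := outflow y v - inflow y v.

(** Vanishing on [F] and at disabled actions lets [inflow] and [outflow] sum over all pairs. *)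
Definition proper_flow y :=
  (forall v a, 0 <= y v a) /\
  (forall v a, (v \in F) || (a \notin mdp_enabled M v) -> y v a = 0).

Lemma inflow_sum (I : finType) (P : pred I) (c : I -> R) (y : I -> V -> G -> R) v :
  inflow (fun v a => \sum_(i | P i) c i * y i v a) v =
  \sum_(i | P i) c i * inflow (y i) v.
Proof.
under [RHS]eq_bigr do rewrite mulr_sumr.
rewrite exchange_big; apply: eq_bigr => v' _.
under [RHS]eq_bigr do rewrite mulr_sumr.
rewrite exchange_big; apply: eq_bigr => a' _.
by rewrite mulr_sumr; apply: eq_bigr => i _; rewrite mulrCA.
Qed.

Lemma outflow_sum (I : finType) (P : pred I) (c : I -> R) (y : I -> V -> G -> R) v :
  outflow (fun v a => \sum_(i | P i) c i * y i v a) v =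
  \sum_(i | P i) c i * outflow (y i) v.
Proof.
rewrite /outflow exchange_big; apply: eq_bigr => i _; by rewrite mulr_sumr.
Qed.

Lemma net_sum (I : finType) (P : pred I) (c : I -> R) (y : I -> V -> G -> R) v :
  net (fun v a => \sum_(i | P i) c i * y i v a) v = \sum_(i | P i) c i * net (y i) v.
Proof.
rewrite /net outflow_sum inflow_sum -sumrB.
by apply: eq_bigr => i _; rewrite mulrBr.
Qed.

Lemma inflowD (c : R) y z v :
  inflow (fun v a => y v a + c * z v a) v = inflow y v + c * inflow z v.
Proof.
rewrite /inflow mulr_sumr -big_split; apply: eq_bigr => v' _.
rewrite mulr_sumr -big_split; apply: eq_bigr => a' _ /=; ring.
Qed.

Lemma outflowD (c : R) y z v :
  outflow (fun v a => y v a + c * z v a) v = outflow y v + c * outflow z v.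
Proof. by rewrite /outflow mulr_sumr -big_split. Qed.

Lemma netD (c : R) y z v :
  net (fun v a => y v a + c * z v a) v = net y v + c * net z v.
Proof. by rewrite /net inflowD outflowD; ring. Qed.

Lemma inflow_ge0 y v : (forall v a, 0 <= y v a) -> 0 <= inflow y v.
Proof.
move=> y0; apply: sumr_ge0 => v' _; apply: sumr_ge0 => a' _.
by rewrite mulr_ge0 ?mdp_trans_ge0.
Qed.

Lemma sum_inflow_le y : (forall v a, 0 <= y v a) ->
  \sum_v inflow y v <= \sum_v outflow y v.
Proof.
move=> y0; rewrite /inflow exchange_big/=; apply: ler_sum => v' _.
rewrite exchange_big/=; apply: ler_sum => a' _.
by rewrite -mulr_suml ler_piMl// mdp_trans_le1.
Qed.

Lemma proper_flowD (c : R) y z : 0 <= c -> proper_flow y -> proper_flow z ->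
  proper_flow (fun v a => y v a + c * z v a).
Proof.
move=> c0 [y0 yE] [z0 zE]; split=> v a; first by rewrite addr_ge0// mulr_ge0.
by move=> va; rewrite yE// zE// mulr0 addr0.
Qed.

Lemma proper_flow_sum (I : finType) (P : pred I) (c : I -> R) (y : I -> V -> G -> R) :
  (forall i, P i -> 0 <= c i) -> (forall i, P i -> proper_flow (y i)) ->
  proper_flow (fun v a => \sum_(i | P i) c i * y i v a).
Proof.
move=> c0 py; split=> v a.
  by apply: sumr_ge0 => i Pi; rewrite mulr_ge0 ?c0//; case: (py i Pi).
by move=> va; apply: big1 => i Pi; case: (py i Pi) => _ ->; rewrite ?mulr0.
Qed.

(** * Expected numbers of visits as a flow *)

Section visits.
Variables (s : strategy M) (alpha : fdist R V).

(** Zero on [F], where the linear system has no action variables and an absorbed run would be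
    counted at every step. *)
Definition visits N v a : R :=
  if v \in F then 0 else \sum_(n < N) occ s alpha n v a.

Lemma visits_proper N : proper_flow (visits N).
Proof.
split=> v a; rewrite /visits.
  by case: ifP => // _; apply: sumr_ge0 => n _; exact: occ_ge0.
by case: ifP => //= _ na; rewrite big1// => n _; exact: occ_disabled.
Qed.

(** The full occupation at time [n] flows into time [n.+1]. The part cut out on [F] would have
    returned to its own state. *)
Lemma inflow_occ n v :
  inflow (fun v' a' => if v' \in F then 0 else occ s alpha n v' a') v =
  occ_state s alpha n.+1 v - (if v \in F then occ_state s alpha n v else 0).
Proof.
apply/esym/eqP; rewrite subr_eq; apply/eqP; rewrite occ_stateS.
have -> : (if v \in F then occ_state s alpha n v else 0) =
    \sum_(v' in F) \sum_a' mdp_trans M v' a' v * occ s alpha n v' a'.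
  case: ifPn => vF; last first.
    rewrite big1// => v' v'F; rewrite big1// => a' _.
    rewrite (absorbing_trans_out _ (F_absorbing v'F)) ?mul0r//.
    by apply: contraNneq vF => ->.
  rewrite (bigD1 v)//= [X in _ + X]big1 ?addr0; last first.
    move=> v' /andP[v'F v'v]; rewrite big1// => a' _.
    by rewrite (absorbing_trans_out _ (F_absorbing v'F)) ?mul0r// eq_sym.
  apply: eq_bigr => a' _; case: (boolP (a' \in mdp_enabled M v)) => aE.
    by rewrite (absorbing_trans _ (F_absorbing vF))// eqxx mul1r.
  by rewrite occ_disabled// mulr0.
rewrite [X in _ + X]big_mkcond -big_split/=; apply: eq_bigr => v' _.
case: ifP => _; last by rewrite addr0.
by rewrite [X in X + _]big1 ?add0r// => a' _; rewrite mulr0.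
Qed.

Lemma inflow_visits N v : inflow (visits N) v =
  \sum_(n < N) (occ_state s alpha n.+1 v -
                (if v \in F then occ_state s alpha n v else 0)).
Proof.
under [RHS]eq_bigr do rewrite -inflow_occ -[inflow _ _]mul1r.
rewrite -inflow_sum; apply: eq_bigr => v' _; apply: eq_bigr => a' _.
rewrite /visits; congr (_ * _); case: ifP => _.
  by rewrite big1// => n _; rewrite mulr0.
by apply: eq_bigr => n _; rewrite mul1r.
Qed.

(** Telescoping: each summand is the mass newly arriving at [v], and none starts there. *)
Lemma inflow_visits_target N v : v \in F -> alpha v = 0 ->
  inflow (visits N) v = occ_state s alpha N v.
Proof.
move=> vF av; rewrite inflow_visits vF.
elim: N => [|N IH]; first by rewrite big_ord0 occ_state0.
by rewrite big_ord_recr/= IH; ring.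
Qed.

Lemma outflow_visits N v : v \notin F ->
  outflow (visits N) v = \sum_(n < N) occ_state s alpha n v.
Proof.
move=> vF; rewrite /outflow /visits (negPf vF) exchange_big.
by apply: eq_bigr.
Qed.

Lemma outflow_visitsS N v : v \notin F ->
  outflow (visits N.+1) v = alpha v + inflow (visits N) v.
Proof.
move=> vF; rewrite outflow_visits// big_ord_recl occ_state0 inflow_visits.
by congr (_ + _); apply: eq_bigr => n _; rewrite (negPf vF) subr0.
Qed.

(** Everything that starts at or enters [v] up to time [N] is sent on, except the mass present at
    time [N]. *)
Lemma net_visits N v : v \notin F ->
  net (visits N) v = alpha v - occ_state s alpha N v.
Proof.
move=> vF; have := outflow_visitsS N vF; rewrite /net !outflow_visits//.
by rewrite big_ord_recr/= => ?; lra.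
Qed.

End visits.

(** * Routing leftover mass into the targets *)

Section draining.

(* The mass [mu] outside [F] can be routed by a finite flow into [F] and the
   dead state, up to the remainder [nu]. *)
Definition drains mu nu :=
  (forall v, 0 <= nu v) /\
  exists2 y, proper_flow y & forall v, v \notin F -> net y v = mu v - nu v.

Definition mass mu : R := \sum_(v | v \notin F) mu v.

(** Part of a unit of mass placed at [v] can be brought into [F] or the dead state. *)
Definition contracting v :=
  exists2 nu, drains (fun u => (u == v)%:R) nu & mass nu < 1.

Definition single v a : V -> G -> R := fun u b => ((u == v) && (b == a))%:R.

Lemma outflow_single v a u : outflow (single v a) u = (u == v)%:R.
Proof.
rewrite /outflow /single (bigD1 a)//= eqxx andbT big1 ?addr0// => b /negPf ->.
by rewrite andbF.
Qed.

Lemma inflow_single v a u : inflow (single v a) u = mdp_trans M v a u.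
Proof.
rewrite /inflow (bigD1 v)//= (bigD1 a)//= /single !eqxx mulr1.
rewrite big1 ?addr0 => [|b /negPf ->]; last by rewrite mulr0.
rewrite big1 ?addr0// => w /negPf wv; rewrite big1// => b _.
by rewrite wv mulr0.
Qed.

Lemma single_proper v a : v \notin F -> a \in mdp_enabled M v ->
  proper_flow (single v a).
Proof.
move=> vF aE; split=> u b; rewrite /single; first by rewrite ler0n.
have [->|//] := eqVneq u v; have [->|//] := eqVneq b a.
by rewrite (negPf vF) aE.
Qed.

(** Play [a] once. The share sent to [u] is absorbed if [u] is in [F], and is otherwise reduced by
    the flow draining [u]. *)
Lemma contracting_step v a u : v \notin F -> a \in mdp_enabled M v ->
  0 < mdp_trans M v a u -> u \in F \/ contracting u -> contracting v.
Proof.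
move=> vF aE p0; have pr1 := mdp_trans_le1 M v a.
have massp : mass (mdp_trans M v a) + \sum_(w in F) mdp_trans M v a w <= 1.
  by move: pr1; rewrite (bigID (fun w => w \in F))/= addrC.
have pF0 : 0 <= \sum_(w in F) mdp_trans M v a w.
  by apply: sumr_ge0 => *; exact: mdp_trans_ge0.
case: (boolP (u \in F)) => [uF _|uF [//|[nu [nu0 [y py ny]] nu1]]].
  exists (mdp_trans M v a).
    split=> [w|]; first exact: mdp_trans_ge0.
    exists (single v a); first exact: single_proper.
    by move=> w _; rewrite /net outflow_single inflow_single.
  move: massp; rewrite (bigD1 u)//=.
  have : 0 <= \sum_(w in F | w != u) mdp_trans M v a w.
    by apply: sumr_ge0 => *; exact: mdp_trans_ge0.
  lra.
set p := mdp_trans M v a u in p0.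
exists (fun w => mdp_trans M v a w - p * (w == u)%:R + p * nu w).
  split=> [w|].
    rewrite addr_ge0 ?mulr_ge0 ?(ltW p0)// subr_ge0.
    by have [->|_] := eqVneq w u; rewrite ?mulr1 ?mulr0 ?mdp_trans_ge0.
  exists (fun w b => single v a w b + p * y w b).
    by apply: proper_flowD (ltW p0) (single_proper vF aE) py.
  by move=> w wF; rewrite netD ny// /net outflow_single inflow_single; ring.
rewrite /mass big_split/= sumrB -!mulr_sumr -/(mass nu) -/(mass _).
have -> : \sum_(i | i \notin F) (i == u)%:R = 1 :> R.
  by rewrite (bigD1 u)//= eqxx big1 ?addr0// => i /andP[_ /negPf ->].
nra.
Qed.

Hypothesis M_clean : cleaned_up M F.

(** By [contracting_step], the states neither in [F] nor contracting are closed under transitions of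
    positive probability. From such a state no strategy reaches [F], so it would be bad. *)
Lemma all_contracting v : v \notin F -> contracting v.
Proof.
move=> vF; apply: contrapT => ncv; apply: (M_clean (v := v)); split=> // -[s].
set P := Pr s _ _ => P0.
have Pfin : P \is a fin_num.
  by rewrite fin_num_measure//; exact: measurable_reach.
have occ0 n u a : u \in F \/ contracting u -> occ s (fdirac R v) n u a = 0.
  have le_state m : 0 <= occ s (fdirac R v) m u a <= occ_state s (fdirac R v) m u.
    rewrite occ_ge0/= /occ_state (bigD1 a)//= lerDl.
    by apply: sumr_ge0 => *; exact: occ_ge0.
  move=> uB; suff st0 : occ_state s (fdirac R v) n u = 0.
    by apply/eqP; rewrite eq_le andbC -st0; have := le_state n; rewrite st0.
  elim: n u a uB {le_state} => [|n IH] u a uB.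
    rewrite occ_state0/=; case: eqP => // uv; subst u.
    by case: uB => // vF'; rewrite vF' in vF.
  rewrite occ_stateS big1// => w _; rewrite big1// => b _.
  have [wB|wB] := pselect (w \in F \/ contracting w).
    suff -> : occ s (fdirac R v) n w b = 0 by rewrite mulr0.
    have := IH w b wB => st0; apply/eqP; rewrite eq_le occ_ge0 andbT -st0.
    rewrite /occ_state (bigD1 b)//= lerDl.
    by apply: sumr_ge0 => *; exact: occ_ge0.
  case: (boolP (b \in mdp_enabled M w)) => bE; last first.
    by rewrite mdp_trans_disabled ?mul0r.
  suff -> : mdp_trans M w b u = 0 by rewrite mul0r.
  apply/eqP; rewrite eq_le mdp_trans_ge0 andbT leNgt; apply/negP => p0.
  apply: wB; case: (boolP (w \in F)) => wF; [by left|right].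
  exact: contracting_step p0 uB.
have Pf : 0 < fine P by rewrite -lte_fin fineK.
have Pe : ((fine P)%:E <= P)%E by rewrite fineK.
(* With half the reaching probability as error, some time still has positive mass in [F]. *)
have Pe2 : 0 < fine P / 2 by rewrite divr_gt0.
have [N _ /(_ N (leqnn _))/=] := reach_absorbing_approx F_absorbing Pe Pe2.
rewrite big1 ?subr_le0; first by rewrite leNgt ltr_pdivrMr// mulr_natr mulr2n ltrDl Pf.
by move=> u uF; rewrite /occ_state big1// => a _; apply: occ0; left.
Qed.

(** Flows draining single states superpose with weights [mu], and finiteness of [V] makes the factor
    uniform. *)
Lemma drain_contraction : exists2 c : R, 0 <= c < 1 &
  forall mu, (forall v, 0 <= mu v) ->
  exists2 nu, drains mu nu & mass nu <= c * mass mu.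
Proof.
have /choice[f Hf] : forall v, exists t : (V -> R) * (V -> G -> R), v \notin F ->
    [/\ forall u, 0 <= t.1 u, proper_flow t.2,
        forall u, u \notin F -> net t.2 u = (u == v)%:R - t.1 u & mass t.1 < 1].
  move=> v; case: (boolP (v \in F)) => vF; first by exists (fun=> 0, fun _ _ => 0).
  by have [nu [nu0 [y py ny]] nu1] := all_contracting vF; exists (nu, y).
(* The default 0 covers the case of no state outside [F]. *)
exists (\big[Num.max/0]_(v | v \notin F) mass (f v).1).
  apply/andP; split; first exact: bigmax_ge_id.
  apply/bigmax_ltP; split=> // v vF; by case: (Hf v vF).
move=> mu mu0; exists (fun u => \sum_(v | v \notin F) mu v * (f v).1 u).
  split.
    move=> u; apply: sumr_ge0 => v vF; rewrite mulr_ge0//.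
    by case: (Hf v vF).
  exists (fun u a => \sum_(v | v \notin F) mu v * (f v).2 u a).
    by apply: proper_flow_sum => // v vF; case: (Hf v vF).
  move=> u uF; rewrite net_sum.
  transitivity (\sum_(v | v \notin F) (mu v * (u == v)%:R - mu v * (f v).1 u)).
    by apply: eq_bigr => v vF; rewrite -mulrBr; case: (Hf v vF) => _ _ ->.
  rewrite sumrB; congr (_ - _); rewrite (bigD1 u)//= eqxx mulr1 big1 ?addr0//.
  by move=> v /andP[_ /negPf]; rewrite eq_sym => ->; rewrite mulr0.
rewrite {1}/mass exchange_big/= mulr_sumr; apply: ler_sum => v vF.
rewrite -mulr_sumr mulrC ler_wpM2r// -/(mass _).
exact: (le_bigmax_cond _ (fun v => mass (f v).1) vF).
Qed.

(** Draining the remainder again and again adds finite flows and shrinks the mass geometrically. *)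
Lemma drain_approx mu (e : R) : (forall v, 0 <= mu v) -> 0 < e ->
  exists2 nu, drains mu nu & mass nu <= e.
Proof.
move=> mu0 e0; have [c /andP[c0 c1] Hc] := drain_contraction.
have iter n : exists2 nu, drains mu nu & mass nu <= c ^+ n * mass mu.
  elim: n => [|n [nu [nu0 [y py ny]] lenu]].
    exists mu; last by rewrite expr0 mul1r.
    split=> //; exists (fun _ _ => 0) => //.
    move=> v _; rewrite subrr /net /outflow /inflow big1// big1 ?subrr// => u _.
    by rewrite big1// => a _; rewrite mulr0.
  have [nu' [nu'0 [z pz nz]] lenu'] := Hc nu nu0; exists nu'.
    split=> //; exists (fun v a => y v a + 1 * z v a).
      exact: proper_flowD.
    by move=> v vF; rewrite netD ny// nz//; ring.
  by rewrite (le_trans lenu')// exprS -mulrA ler_wpM2l.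
have m0 : 0 <= mass mu by apply: sumr_ge0.
have [N _ /(_ N (leqnn _))/= cN] : \forall n \near \oo%classic, c ^+ n < e / (mass mu + 1).
  apply: (@cvgr_lt _ _ _ _ _ 0); first by apply: cvg_expr; rewrite ger0_norm.
  by rewrite divr_gt0// ltr_wpDl.
have [nu dnu lenu] := iter N; exists nu => //; apply: (le_trans lenu).
move: cN; rewrite ltr_pdivlMr ?ltr_wpDl//.
by have := exprn_ge0 N c0; nra.
Qed.

End draining.

End flows.

(** * Equivalence *)

Section equivalence.
Variables (R : realType) (V G : finType) (M : mdp R V G) (F : {set V}).
Hypothesis F_absorbing : forall v, v \in F -> absorbing M v.
Variables (alpha : fdist R V).
Hypothesis alpha_supp : forall v, v \in F -> alpha v = 0.

(** Otherwise [w] would drop by more than [e] at every step and become negative. *)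
Lemma small_decrement (w : nat -> R) (e : R) : (forall n, 0 <= w n) -> 0 < e ->
  exists n, w n - w n.+1 <= e.
Proof.
move=> w0 e0; apply: contrapT => H.
have dec n : w n.+1 <= w n - e.
  have [le|/ltW] := leP (w n - w n.+1) e; last by lra.
  by case: H; exists n.
have bnd n : w n <= w 0 - n%:R * e.
  elim: n => [|n IH]; first by rewrite mul0r subr0.
  by rewrite -natr1; have := dec n; lra.
pose n := Num.bound (w 0 / e).
have : w 0 / e < n%:R by rewrite archi_boundP// divr_ge0// ltW.
by rewrite ltr_pdivrMr//; have := bnd n; have := w0 n; lra.
Qed.

(** * From a solution of the linear system to a memoryless strategy *)

Section lp_to_strategy.
Variables (yF : V -> R) (yA : V -> G -> R).
Hypothesis feas : lp_feasible M F alpha yF yA.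

Definition lp_flow v a : R :=
  if (v \notin F) && (a \in mdp_enabled M v) then yA v a else 0.

Lemma lp_flow_proper : proper_flow M F lp_flow.
Proof.
case: feas => _ _ _ y0; split=> v a; rewrite /lp_flow.
  by case: ifP => // /andP[]; exact: y0.
by case/orP => [->|/negPf ->]; rewrite ?andbF.
Qed.

Lemma inflow_lp_flow v : inflow M lp_flow v =
  \sum_(v' | v' \notin F) \sum_(a' in mdp_enabled M v') mdp_trans M v' a' v * yA v' a'.
Proof.
rewrite [RHS]big_mkcond; apply: eq_bigr => v' _; rewrite /lp_flow.
case: ifP => _; last by rewrite big1// => a' _; rewrite mulr0.
rewrite [RHS]big_mkcond; apply: eq_bigr => a' _ /=; case: ifP => // _.
by rewrite mulr0.
Qed.

(** The first constraint family also sums over target states, but these lead only to themselves and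
    contribute nothing outside [F]. *)
Lemma net_lp_flow v : v \notin F -> net M lp_flow v = alpha v.
Proof.
case: feas => H _ _ _ vF; rewrite -(H v vF); congr (_ - _).
  rewrite /outflow [RHS]big_mkcond; apply: eq_bigr => a _.
  by rewrite /lp_flow vF.
rewrite inflow_lp_flow big_mkcond; apply: eq_bigr => v' _; case: ifPn => //.
rewrite negbK => v'F; rewrite big1// => a' _.
rewrite (absorbing_trans_out _ (F_absorbing v'F)) ?mul0r//.
by apply: contraNneq vF => ->.
Qed.

Lemma yF_lp_flow v : v \in F -> yF v = inflow M lp_flow v.
Proof.
by case: feas => _ H _ _ /H /eqP; rewrite subr_eq0 inflow_lp_flow => /eqP.
Qed.

(** Normalise by the outflow. Where it is 0 all values at the state vanish, and any enabled action
    will do. *)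
Lemma lp_strategy : exists s : strategy M, memoryless s /\
  forall v a, lp_flow v a = outflow lp_flow v * s [::] v a.
Proof.
have [y0 yE] := lp_flow_proper.
have /choice[d Hd] : forall v, exists d : fdist R G,
    (forall a, 0 < d a -> a \in mdp_enabled M v) /\
    forall a, lp_flow v a = outflow lp_flow v * d a.
  move=> v; have x0 : 0 <= outflow lp_flow v by apply: sumr_ge0.
  have [xv|xv] := eqVneq (outflow lp_flow v) 0.
    have /set0Pn[b bE] := mdp_enabled_neq0 M v.
    exists (fdirac R b); split=> a /=.
      by case: eqP => [->//|_]; rewrite ltxx.
    rewrite xv mul0r; apply/eqP.
    by move/eqP: xv; rewrite psumr_eq0// => /allP; apply; rewrite mem_index_enum.
  have dge a : 0 <= lp_flow v a / outflow lp_flow v by rewrite divr_ge0.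
  have dsum : \sum_a lp_flow v a / outflow lp_flow v = 1.
    by rewrite -mulr_suml divff.
  exists (FDist dge dsum); split=> a /=; last by rewrite mulrC divfK.
  case: (boolP (a \in mdp_enabled M v)) => // aE.
  by rewrite yE ?aE ?orbT// mul0r ltxx.
exists (Strategy (strat_fun := fun=> d) (fun _ v a => (Hd v).1 a)); split=> //.
by move=> v a; have [_ ->] := Hd v.
Qed.

(* The excess [lp_flow - visits N] is a nonnegative flow whose total outflow
   decreases with [N] by at least what it sends into [F]; hence it sends
   arbitrarily little into [F] for some [N]. Part of [lp_flow] may circulate
   without being reachable from [alpha], so the excess need not vanish. *)
Lemma lp_memoryless : exists s : strategy M, memoryless s /\
  forall S : {set V}, S \subset F ->
  ((\sum_(v in S) yF v)%:E <= Pr s alpha (reach S))%E.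
Proof.
have [y0 yE] := lp_flow_proper.
have [s [ms sE]] := lp_strategy; exists s; split=> // S SF.
pose W N v a := lp_flow v a + (-1) * visits F s alpha N v a.
(* Both flows split among actions in the proportions of [s]: [lp_flow] by choice of [s], [visits]
   because [s] is memoryless. *)
have WE N v a : W N v a = outflow (W N) v * s [::] v a.
  rewrite outflowD mulrDl -sE /W; congr (_ + _).
  rewrite -mulrA; congr (_ * _); rewrite /outflow /visits.
  case: ifPn => vF; first by rewrite big1 ?mul0r.
  rewrite exchange_big mulr_suml; apply: eq_bigr => n _.
  by rewrite occ_memoryless.
have WF N v : v \in F -> outflow (W N) v = 0.
  move=> vF; apply: big1 => a _; rewrite /W /visits vF yE ?vF//.
  by rewrite mulr0 addr0.
(* The source [alpha] cancels between the two flows; this recurrence carries nonnegativity from [N]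
   to [N.+1]. *)
have WS N v : v \notin F -> outflow (W N.+1) v = inflow M (W N) v.
  move=> vF; rewrite outflowD inflowD outflow_visitsS//.
  by have := net_lp_flow vF; rewrite /net => ?; lra.
have W0 N v a : 0 <= W N v a.
  elim: N v a => [|N IH] v a.
    rewrite /W /visits big_ord0; case: ifP => _; by rewrite mulr0 addr0.
  rewrite WE mulr_ge0 ?fdist_ge0//.
  case: (boolP (v \in F)) => vF; first by rewrite WF.
  by rewrite WS// inflow_ge0.
apply/lee_addgt0Pr => e e0.
have [|N HN] := @small_decrement (fun N => \sum_v outflow (W N) v) e _ e0.
  by move=> N; apply: sumr_ge0 => v _; apply: sumr_ge0.
apply: (@le_trans _ _ (\sum_(v in S) occ_state s alpha N v + e)%:E); last first.
  by rewrite EFinD leeD2r// Pr_at_time_le_reach.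
rewrite lee_fin.
have -> : \sum_(v in S) yF v =
    \sum_(v in S) occ_state s alpha N v + \sum_(v in S) inflow M (W N) v.
  rewrite -big_split; apply: eq_bigr => v /(fintype.subsetP SF) vF /=.
  rewrite yF_lp_flow// inflowD inflow_visits_target ?alpha_supp//; ring.
rewrite lerD2l.
have leSF : \sum_(v in S) inflow M (W N) v <= \sum_(v in F) inflow M (W N) v.
  rewrite [leRHS](big_setID S)/= (finset.setIidPr SF) lerDl.
  by apply: sumr_ge0 => v _; exact: inflow_ge0.
(* Total inflow of [W N] is at most its total outflow, and its part outside [F] is the total outflow
   of [W N.+1]; so the inflow into [F] is at most the decrement. *)
apply: le_trans leSF (le_trans _ HN); rewrite lerBrDr.
apply: le_trans _ (sum_inflow_le M (W0 N)).
rewrite [leRHS](bigID (fun v => v \in F))/= lerD2l.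
rewrite (bigID (fun v => v \in F))/= [X in X + _]big1 ?add0r; last first.
  by move=> v vF; rewrite WF.
by apply: ler_sum => v vF; rewrite WS.
Qed.

End lp_to_strategy.

(** * From an arbitrary strategy to a solution of the linear system *)

Section strategy_to_lp.
Variables (k : nat) (Fi : 'I_k -> {set V}) (r : 'I_k -> R).
Hypothesis FiF : forall i, Fi i \subset F.

(** Visits up to a late time, plus a flow draining the mass then left outside [F]. Draining can only
    increase the inflow into targets. *)
Lemma achievable_approx_lp (s : strategy M) (e : R) : cleaned_up M F ->
  (forall i, ((r i)%:E <= Pr s alpha (reach (Fi i)))%E) -> 0 < e ->
  exists y, [/\ proper_flow M F y,
    forall v, v \notin F -> `|net M y v - alpha v| <= e &
    forall i, r i - e <= \sum_(v in Fi i) inflow M y v].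
Proof.
move=> Mc sr e0.
have [N _ /(_ N (leqnn _))/= HN] : \forall n \near \oo%classic,
    forall i, r i - e <= \sum_(v in Fi i) occ_state s alpha n v.
  apply: filter_forall => i; apply: reach_absorbing_approx => // v.
  by move=> /(fintype.subsetP (FiF i)); exact: F_absorbing.
have [|nu [nu0 [z pz nz]] nue] :=
    @drain_approx _ _ _ _ _ F_absorbing Mc (occ_state s alpha N) e _ e0.
  by move=> v; apply: sumr_ge0 => a _; exact: occ_ge0.
have pY := visits_proper F s alpha N.
exists (fun v a => visits F s alpha N v a + 1 * z v a); split.
- exact: proper_flowD.
- move=> v vF; rewrite netD net_visits// nz//.
  rewrite (_ : _ - alpha v = - nu v); last by ring.
  rewrite normrN ger0_norm//; apply: le_trans nue.
  by rewrite /mass (bigD1 v)//= lerDl sumr_ge0.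
- move=> i; apply: (le_trans (HN i)); apply: ler_sum => v vFi.
  have vF := fintype.subsetP (FiF i) _ vFi.
  rewrite inflowD inflow_visits_target ?alpha_supp// lerDl mul1r inflow_ge0//.
  by case: pz.
Qed.

Lemma approx_lp_feasible :
  (forall e, 0 < e -> exists y, [/\ proper_flow M F y,
    forall v, v \notin F -> `|net M y v - alpha v| <= e &
    forall i, r i - e <= \sum_(v in Fi i) inflow M y v]) ->
  exists y, [/\ proper_flow M F y,
    forall v, v \notin F -> net M y v = alpha v &
    forall i, r i <= \sum_(v in Fi i) inflow M y v].
Proof.
move=> H.
pose p v (q : V * G) := mdp_trans M q.1 q.2 v.
(* Rows, in order: conservation in both directions (trivial on [F]), nonnegativity, vanishing at
   forbidden pairs, target values. Only the sign and support rows hold without error. *)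
pose I := (((V + V) + ((V * G) + (V * G))) + 'I_k)%type.
pose nrow v q : R := if v \in F then 0 else (q.1 == v)%:R - p v q.
pose off q := (q.1 \in F) || (q.2 \notin mdp_enabled M q.1).
pose A (i : I) (q : V * G) : R := match i with
  | inl (inl (inl v)) => nrow v q
  | inl (inl (inr v)) => - nrow v q
  | inl (inr (inl q')) => - (q == q')%:R
  | inl (inr (inr q')) => if off q' then (q == q')%:R else 0
  | inr i => - \sum_(v in Fi i) p v q end.
pose b (i : I) : R := match i with
  | inl (inl (inl v)) => if v \in F then 0 else alpha v
  | inl (inl (inr v)) => if v \in F then 0 else - alpha v
  | inr i => - r i
  | _ => 0 end.
pose c (i : I) : R := match i with
  | inl (inl _) | inr _ => 1 | inl (inr _) => 0 end.
have pE v (x : V * G -> R) :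
    \sum_q p v q * x q = inflow M (fun v a => x (v, a)) v.
  by rewrite /inflow pair_big/=; apply: eq_bigr => -[].
have nE v (x : V * G -> R) : v \notin F ->
    \sum_q nrow v q * x q = net M (fun v a => x (v, a)) v.
  move=> vF; rewrite /net -pE /nrow (negPf vF).
  under eq_bigr do rewrite mulrBl; rewrite sumrB; congr (_ - _).
  transitivity (\sum_u \sum_a (u == v)%:R * x (u, a)).
    by rewrite pair_big/=; apply: eq_bigr => -[].
  rewrite (bigD1 v)//= [X in _ + X]big1 ?addr0.
    by apply: eq_bigr => a _; rewrite eqxx mul1r.
  by move=> u /negPf ->; apply: big1 => a _; rewrite mul0r.
have nF v (x : V * G -> R) : v \in F -> \sum_q nrow v q * x q = 0.
  by move=> vF; apply: big1 => q _; rewrite /nrow vF mul0r.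
have dE q' (x : V * G -> R) : \sum_q (q == q')%:R * x q = x q'.
  rewrite (bigD1 q')//= eqxx mul1r big1 ?addr0// => q /negPf ->.
  by rewrite mul0r.
have sE i (x : V * G -> R) : \sum_q (\sum_(v in Fi i) p v q) * x q =
    \sum_(v in Fi i) inflow M (fun v a => x (v, a)) v.
  under [RHS]eq_bigr do rewrite -pE.
  by rewrite exchange_big; apply: eq_bigr => q _; rewrite mulr_suml.
have oppE (f x : V * G -> R) : \sum_q - f q * x q = - \sum_q f q * x q.
  by rewrite -sumrN; apply: eq_bigr => q _; rewrite mulNr.
have [|x Hx] := @approx_feasible R I _ A b c.
  move=> e e0; have [y [[y0 yE] ny fy]] := H e e0.
  exists (fun q => y q.1 q.2); case=> [[[v|v]|[[v a]|[v a]]]|i] /=; rewrite ?oppE.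
  - case: ifPn => vF; first by rewrite nF// ?oppr0 add0r mulr1 ltW.
    by rewrite nE//; have := ny v vF; rewrite ler_norml => /andP[]; lra.
  - case: ifPn => vF; first by rewrite nF// ?oppr0 add0r mulr1 ltW.
    by rewrite nE//; have := ny v vF; rewrite ler_norml => /andP[]; lra.
  - by rewrite dE/= mulr0 addr0 oppr_le0.
  - rewrite mulr0 addr0; case o : (off (v, a)); first by rewrite dE/= yE.
    by rewrite big1// => q _; rewrite mul0r.
  - by rewrite sE/=; have := fy i; lra.
exists (fun v a => x (v, a)).
have x0 v a : 0 <= x (v, a).
  by have := Hx (inl (inr (inl (v, a)))); rewrite /= oppE dE oppr_le0.
split.
- split=> // v a o; apply/eqP; rewrite eq_le x0 andbT.
  by have := Hx (inl (inr (inr (v, a)))); rewrite /= /off/= o dE.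
- move=> v vF; apply/eqP; rewrite eq_le.
  have := Hx (inl (inl (inl v))); have := Hx (inl (inl (inr v))).
  by rewrite /= oppE nE// (negPf vF) lerN2 => -> ->.
- by move=> i; have := Hx (inr i); rewrite /= oppE sE lerN2.
Qed.

(** Taking the inflow as target values makes the second constraint family an identity. *)
Lemma proper_flow_lp y : proper_flow M F y ->
  (forall v, v \notin F -> net M y v = alpha v) ->
  lp_feasible M F alpha (inflow M y) y.
Proof.
move=> [y0 yE] ny.
(* One family sums over all states, the other over those outside [F]; for a proper flow both sums
   are the inflow. *)
have infE v (P : pred V) : (forall v', ~~ P v' -> v' \in F) ->
    \sum_(v' | P v') \sum_(a' in mdp_enabled M v') mdp_trans M v' a' v * y v' a' =
    inflow M y v.
  move=> PF; rewrite big_mkcond; apply: eq_bigr => v' _; case: ifPn => Pv.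
    rewrite big_mkcond; apply: eq_bigr => a' _; case: ifPn => // na.
    by rewrite mdp_trans_disabled ?mul0r.
  by rewrite big1// => a' _; rewrite yE ?PF// mulr0.
split=> [v vF|v vF|v _|v a _ _] //; last exact: inflow_ge0.
- rewrite infE// -(ny v vF); congr (_ - _).
  rewrite big_mkcond; apply: eq_bigr => a _; case: ifPn => // na.
  by rewrite yE// na orbT.
- by rewrite infE ?subrr// => v'; rewrite negbK.
Qed.

End strategy_to_lp.

End equivalence.

Theorem theorem3p2 (R : realType) (V G : finType) (M : mdp R V G)
    (k : nat) (Fi : 'I_k -> {set V}) (F : {set V})
    (alpha : fdist R V) (r : 'I_k -> R)
    (defF : F = (\bigcup_(i < k) Fi i)%SET)
    (F_absorbing : forall v, v \in F -> absorbing M v)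
    (M_clean : cleaned_up M F)
    (alpha_supp : forall v, v \in F -> alpha v = 0)
    (r_01 : forall i, 0 < r i <= 1) :
  let memoryless_achievable :=
    exists s : strategy M, memoryless s /\
      forall i, ((r i)%:E <= Pr s alpha (reach (Fi i)))%E in
  let lp_achievable :=
    exists (yF : V -> R) (yA : V -> G -> R),
      lp_feasible M F alpha yF yA /\
      forall i, r i <= \sum_(v in Fi i) yF v in
  let achievable :=
    exists s : strategy M,
      forall i, ((r i)%:E <= Pr s alpha (reach (Fi i)))%E in
  (memoryless_achievable <-> lp_achievable) /\
  (lp_achievable <-> achievable).
Proof.
move=> mem lp ach.
have FiF i : Fi i \subset F by rewrite defF; exact: (finset.bigcup_sup i).
have mem_ach : mem -> ach by move=> [s [_ sr]]; exists s.
have lp_mem : lp -> mem.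
  move=> [yF [yA [feas yr]]].
  have [s [ms Hs]] := lp_memoryless F_absorbing alpha_supp feas.
  by exists s; split=> // i; apply: le_trans (Hs _ (FiF i)); rewrite lee_fin.
have ach_lp : ach -> lp.
  move=> [s sr].
  have [y [py ny fy]] := approx_lp_feasible (fun e =>
    @achievable_approx_lp _ _ _ _ _ F_absorbing _ alpha_supp _ _ _ FiF s e M_clean sr).
  by exists (inflow M y), y; split=> //; exact: proper_flow_lp.
by split; split=> [|]; auto.
Qed.
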